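(* Let $d\in\mathbb{N}$ and $p(z)=\sum_{k=0}^dc_kz^k$, $c_k\in\mathbb{C}$, $c_d\ne0$, $c_0\ne0$. Let $H_n(t)$, $n\in\mathbb{Z}_+$, be the Hermite polynomials, with generating function $e^{2tw-w^2}=\sum_{n=0}^\infty H_n(t)\frac{w^n}{n!}$, and let $$\varphi_n(t)=\sum_{j=0}^n\binom njb_j\,H_{n-j}(t),\qquad b_j=\left(\frac{1}{p(2w)}\right)^{(j)}(0),\qquad n\in\mathbb{Z}_+.$$ The polynomials $\{\varphi_n(t)\}_{n=0}^\infty$ satisfy the recurrence relation $$(n+1)\sum_{k=0}^d\varphi_{n+1-k}(t)\frac{c_k2^k}{(n+1-k)!}+2\sum_{k=0}^d\varphi_{n-1-k}(t)\frac{c_k2^k}{(n-1-k)!}=2t\left(\sum_{k=0}^d\varphi_{n-k}(t)\frac{c_k2^k}{(n-k)!}\right),\qquad n\in\mathbb{N},$$ where $\varphi_r:=0$, $r!:=1$, for $r\in\mathbb{Z}$, $r<0$; and $$c_0\varphi_1(t)+2c_1\varphi_0(t)=2c_0t\,\varphi_0(t).$$ The polynomials $\{\varphi_n(t)\}_{n=0}^\infty$ obey the differential equation $$\sum_{k=0}^dc_k\varphi_n^{(k+2)}(t)-2t\sum_{k=0}^dc_k\varphi_n^{(k+1)}(t)=-2n\left(\sum_{k=0}^dc_k\varphi_n^{(k)}(t)\right),\qquad n\in\mathbb{Z}_+.$$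
   Context: $\mathbb{N}$: positive integers; $\mathbb{Z}_+$: non-negative integers. The superscript $(j)$ in $b_j$ denotes the $j$-th derivative with respect to $w$. (This is the case $g_n=H_n$, $f(w)=e^{-w^2}$, $u(w)=2w$ of the polynomials $\varphi_n(t)=\sum_{j=0}^n\binom njb_jg_{n-j}(t)$, $b_j=\left(\frac1{p(u(w))}\right)^{(j)}(0)$, where $\sum_{n\ge0}g_n(t)w^n/n!=f(w)e^{tu(w)}$; equivalently, near $w=0$, $\sum_{n\ge0}\varphi_n(t)w^n/n!=\frac{1}{p(2w)}e^{2tw-w^2}$.) *)

(* Defs.v *)
From HB Require Import structures.
From mathcomp Require Import all_boot all_order all_algebra.
From mathcomp Require Import complex.
From mathcomp Require Import all_classical all_reals all_analysis.

Set Implicit Arguments.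
Unset Strict Implicit.
Unset Printing Implicit Defensive.

Import Order.TTheory GRing.Theory Num.Theory.
Import numFieldNormedType.Exports.

Local Open Scope classical_set_scope.
Local Open Scope ring_scope.

(* The Hermite polynomials have real coefficients, so they are taken in
   {poly R} and the generating function is asked for at real t and w only;
   this determines H uniquely, and it is the weakest form of the condition. *)
Definition is_hermite (R : realType) (H : nat -> {poly R}) : Prop :=
  forall t w : R,
    series (fun n => (H n).[t] * w ^+ n / n`!%:R) @ \oo
      --> expR (2 * t * w - w ^+ 2).

(* The derivative is the complex one: R[i] is regarded as a normed module over
   itself.  The value of the inverse at the zeros of p is immaterial, since p
   does not vanish near 0 when p.[0] != 0. *)
Definition bcoef (R : realType) (p : {poly R[i]}) (j : nat) : R[i] :=
  derive1n j (fun w : R[i] => (p.[2 * w])^-1 : R[i]^o) 0.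

Definition phi (R : realType) (H : nat -> {poly R}) (p : {poly R[i]})
    (n : nat) : {poly R[i]} :=
  \sum_(0 <= j < n.+1)
     ('C(n, j)%:R * bcoef p j) *: map_poly (real_complex R) (H (n - j)%N).

(* Extension to integer indices: phi_r := 0 and r! := 1 for r < 0. *)
Definition phiz (R : realType) (H : nat -> {poly R}) (p : {poly R[i]})
    (r : int) : {poly R[i]} :=
  if r is Posz n then phi H p n else 0.

Definition factz (r : int) : nat := if r is Posz n then n`! else 1%N.

(* Main.v *)
Require Import Defs.
From HB Require Import structures.
From mathcomp Require Import all_boot all_order all_algebra.
From mathcomp Require Import complex ring lra.
From mathcomp Require Import all_classical all_reals all_analysis.

Import Order.TTheory GRing.Theory Num.Theory.
Import numFieldNormedType.Exports.

Local Open Scope ring_scope.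

(** Write A(w) = p(2w) = sum_k a_k w^k, so that a_k = 2^k c_k, and let
    psi_n = phi_n / n!, h_n = H_n / n!, beta_j = b_j / j!.  By definition psi is
    the convolution of beta and h, and beta is the Taylor sequence of 1/A at 0,
    that is, the convolution inverse of a ([inv_coefs]).  Hence a * psi = h
    ([appell_conv]), which says that each sum
      sum_k c_k 2^k phi_(m-k) / (m-k)!
    of the statement is H_m / m!.  The recurrence for phi is therefore the
    three-term recurrence of the Hermite polynomials divided by n!, and the
    initial relation is the case m = 0, 1 of the same identity.

    Since H_n' = 2n H_(n-1), also phi_n' = 2n phi_(n-1) ([appell_deriv]); thus
    the k-th derivative of phi_n is 2^k n!/(n-k)! phi_(n-k), and the identity
    a * psi = h becomes sum_k c_k phi_n^(k) = H_n.  The differential equation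
    for phi is then the one of H_n ([hermite_ode]).

    Two facts come from analysis.  For the b_j, Leibniz' formula is applied to
    A * (1/A) = 1 on the open set where A does not vanish; this needs all the
    derivatives of 1/A there, which are given explicitly as rational functions.
    For the Hermite polynomials, the generating function E(w) satisfies
    E' = (2t - 2w) E; differentiating its power series termwise and comparing
    coefficients gives the three-term recurrence ([hermite_gen_coef]), from
    which the remaining properties of H_n follow by algebra. *)

Lemma natr_fact_neq0 (F : numDomainType) n : (n`!%:R : F) != 0.
Proof. by rewrite pnatr_eq0 -lt0n fact_gt0. Qed.

(** * Iterated derivatives and the Leibniz formula *)

(** A sequence of functions each of which is the derivative of the previous one
    on [U].  Exhibiting such a sequence identifies the iterated derivatives of
    its first term without any separate proof of differentiability. *)
Definition jet_on {K : numFieldType} (U : set K) (G : nat -> K -> K) :=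
  forall n w, U w -> is_derive (w : K^o) 1 (G n : K -> K^o) (G n.+1 w).

(** Openness of [U] is what lets an equality on [U] pass to derivatives: at each
    point of [U] it holds in a neighbourhood. *)
Lemma jet_on_derive1n (K : numFieldType) (U : set K) (G : nat -> K -> K)
    (f : K -> K^o) :
  open U -> jet_on U G -> (forall w, U w -> f w = G 0%N w) ->
  forall n w, U w -> derive1n n f w = G n w.
Proof.
move=> oU jG fG; elim=> [|n IHn] w Uw; first exact: fG.
rewrite derive1nS derive1E.
have eqG : {near w, derive1n n f =1 G n}.
  by near=> v; apply: IHn; near: v; exact: open_nbhs_nbhs.
rewrite (near_eq_derive _ eqG) //.
exact: (@derive_val _ _ _ _ _ _ _ (jG n w Uw)).
Unshelve. all: by end_near. Qed.

(** The Pascal-rule bookkeeping of the inductive step in Leibniz' formula, with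
    [T i j] standing for the product of an i-th and a j-th derivative. *)
Lemma leibniz_sum (S : pzRingType) (T : nat -> nat -> S) n :
  \sum_(k < n.+1) 'C(n, k)%:R * (T k.+1 (n - k)%N + T k (n - k).+1)
  = \sum_(k < n.+2) 'C(n.+1, k)%:R * T k (n.+1 - k)%N.
Proof.
under eq_bigr do rewrite mulrDr.
rewrite big_split /= [RHS]big_ord_recl /= bin0 subn0.
under [in RHS]eq_bigr => i _ do rewrite /bump add1n subSS binS natrD mulrDl.
rewrite big_split /= addrA [LHS]addrC; congr +%R.
rewrite big_ord_recl /= bin0 subn0; congr +%R.
rewrite [RHS]big_ord_recr /= bin_small // mul0r addr0.
by apply: eq_bigr => i _; rewrite /bump add1n -subSn ?ltn_ord// subSS.
Qed.

Lemma jet_on_mul (K : numFieldType) (U : set K) (F G : nat -> K -> K) :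
  jet_on U F -> jet_on U G ->
  jet_on U (fun n w => \sum_(k < n.+1) 'C(n, k)%:R * (F k w * G (n - k)%N w)).
Proof.
move=> jF jG n w Uw.
rewrite -(leibniz_sum K (fun i j => F i w * G j w)) /=.
rewrite (_ : (fun _ => _) = \sum_(k < n.+1)
    ('C(n, k)%:R *: ((F k : K -> K^o) * (G (n - k)%N : K -> K^o)))); last first.
  by apply: funext => v; rewrite fct_sumE; apply: eq_bigr.
apply: is_derive_sum => k.
have dF := jF k w Uw; have dG := jG (n - k)%N w Uw.
apply: is_derive_eq.
by rewrite /GRing.scale /= addrC [G _ w * _]mulrC.
Qed.

Lemma is_derive_horner (K : numFieldType) (A : {poly K}) (w : K) :
  is_derive (w : K^o) 1 (horner A : K -> K^o) A^`().[w].
Proof.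
elim/poly_ind: A => [|A a IHA].
  rewrite deriv0 horner0 (_ : horner _ = cst 0); first exact: is_derive_cst.
  by apply: funext => v; rewrite horner0.
rewrite (_ : horner _ = (horner A : K -> K^o) * id + cst a); last first.
  by apply: funext => v; rewrite !hornerE.
apply: is_derive_eq.
by rewrite !poly.derivE !hornerE /GRing.scale /= mulr1 [w * _]mulrC.
Qed.

Lemma jet_on_horner (K : numFieldType) (U : set K) (A : {poly K}) :
  jet_on U (fun n w => A^`(n).[w]).
Proof. by move=> n w _; rewrite derivnS; exact: is_derive_horner. Qed.

(** The n-th derivative of 1/A is [inv_num A n] / A^(n+1); the recursion is the
    quotient rule. *)
Fixpoint inv_num {K : numFieldType} (A : {poly K}) (n : nat) : {poly K} :=
  if n is m.+1 then
    (inv_num A m)^`() * A - m.+1%:R *: (inv_num A m * A^`())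
  else 1.

Lemma jet_on_inv (K : numFieldType) (A : {poly K}) :
  jet_on [set w | A.[w] != 0]%classic
    (fun n w => (inv_num A n).[w] * A.[w] ^- n.+1).
Proof.
move=> n w /= Aw0.
set N := inv_num A n.
have dN := is_derive_horner K N w.
have dA := is_derive_horner K A w.
have dV : is_derive (w : K^o) 1 ((fun v => (A.[v])^-1) : K -> K^o)
    (- A.[w] ^- 2 *: A^`().[w]).
  split; first exact: derivableV.
  by rewrite deriveV // derive_val.
rewrite (_ : (fun _ => _) = (horner N : K -> K^o) *
   ((fun v => (A.[v])^-1) : K -> K^o) ^+ n.+1); last first.
  by apply: funext => v; rewrite !fctE exprVn.
apply: is_derive_eq.
rewrite -/N !hornerE /GRing.scale /= -!exprVn.
rewrite -mulr_natl /=.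
rewrite fctE.
have := mulfV Aw0; set u := A.[w]^-1 => Au.
rewrite -[X in _ + X]mulr1 -[in X in _ + X]Au.
rewrite !exprS expr0.
ring: Au.
Qed.

Lemma open_horner_neq0 (K : numFieldType) (A : {poly K}) :
  open [set w : K | A.[w] != 0]%classic.
Proof.
rewrite openE => w /= Aw0.
have cA : {for w, continuous (horner A)}.
  exact/differentiable_continuous/derivable1_diffP/ex_derive/is_derive_horner.
have nA : nbhs A.[w] [set v : K | v != 0]%classic.
  apply: open_nbhs_nbhs; split => //.
  rewrite (_ : mkset _ = ~` [set 0])%classic; last first.
    by apply/seteqP; split => v /= /eqP.
  apply: closed_openC; apply: accessible_closed_set1.
  by apply: hausdorff_accessible; exact: (@norm_hausdorff K K^o).
exact: (cA _ nA).
Qed.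

(** Both the Leibniz sequence of A * (1/A) and the sequence 1, 0, 0, ... begin
    with the constant function 1 on the open set where A is nonzero, so they
    agree at 0; dividing the n-th terms by n! says that the Taylor coefficients
    of 1/A are the convolution inverse of the coefficients of A. *)
Lemma inv_coefs (K : numFieldType) (A : {poly K}) n : A.[0] != 0 ->
  \sum_(k < n.+1) A`_k *
     (derive1n (n - k) (fun w => (A.[w])^-1 : K^o) 0 / (n - k)`!%:R)
  = (n == 0%N)%:R.
Proof.
move=> A0; pose U := [set w | A.[w] != 0]%classic.
have oU : open U := open_horner_neq0 K A.
have jV := jet_on_inv K A.
have jM := jet_on_mul K U _ _ (jet_on_horner K U A) jV.
have j1 : jet_on U (fun n _ => (n == 0%N)%:R).
  by move=> m w _; apply: is_derive_cst.
have eqV m : derive1n m (fun w => (A.[w])^-1 : K^o) 0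
    = (inv_num A m).[0] * A.[0] ^- m.+1.
  by rewrite (jet_on_derive1n _ _ _ _ oU jV) // => w _; rewrite hornerC mul1r.
(* The derivatives of the constant 1 are read off in two ways: from the
   sequence 1, 0, 0, ... here, and from the Leibniz sequence in the rewrite. *)
have /esym := jet_on_derive1n _ _ _ (cst 1) oU j1 (fun _ _ => erefl) n 0 A0.
rewrite (jet_on_derive1n _ _ _ _ oU jM) //; last first.
  move=> w Uw; rewrite big_ord1 /= bin0 subnn hornerC !mul1r expr1.
  by rewrite /= mulfV.
move=> eqn; apply: (mulfI (x := n`!%:R)).
  exact: natr_fact_neq0.
transitivity ((n == 0)%:R : K); last first.
  by case: n {eqn} => [|n]; rewrite ?mulr0// mulr1.
rewrite eqn mulr_sumr; apply: eq_bigr => k _; rewrite -eqV.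
rewrite horner_coef0 coef_derivn addn0 ffactnn -[A`_k *+ _]mulr_natr.
have -> : n`!%:R = 'C(n, k)%:R * (k`!%:R * (n - k)`!%:R) :> K.
  by rewrite -!natrM bin_fact // -ltnS.
have : ((n - k)`!%:R : K) != 0 by exact: natr_fact_neq0.
move: (derive1n _ _ _) (A`_k) ('C(n, k)%:R) (k`!%:R) ((n - k)`!%:R).
by move=> D a b x y y0; field.
Qed.

(** * Power series that converge everywhere *)

(** Compare at x with the absolutely convergent series at 2|x| + 1, using
    n + 1 <= 2^n to absorb the factor produced by differentiation. *)
Lemma is_cvg_pseries_diffs (R : realType) (a : nat -> R) :
  (forall x, cvgn (pseries a x)) ->
  forall x, cvgn (pseries (pseries_diffs a) x).
Proof.
move=> ca x; pose z : R := 2 * `|x| + 1.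
have z0 : 0 <= z by rewrite /z addr_ge0// mulr_ge0.
have z1 : 1 <= z by rewrite /z lerDr mulr_ge0.
have cz : cvgn (pseries (fun i => `|a i|) z).
  apply: (is_cvg_pseries_inside_norm (x := z + 1)); first exact: ca.
  by rewrite !ger0_norm ?ltrDl// addr_ge0.
apply: normed_cvg => /=.
apply: (series_le_cvg (v_ := fun i => `|a i.+1| * z ^+ i.+1)).
- by move=> n; rewrite /= normr_ge0.
- by move=> n; rewrite mulr_ge0// exprn_ge0.
- move=> n; rewrite /= /pseries_diffs !normrM normrX normr_nat mulrAC mulrC.
  apply: ler_wpM2l => //.
  have : n.+1%:R * `|x| ^+ n <= (2 * `|x|) ^+ n.
    rewrite exprMn ler_wpM2r// ?exprn_ge0// -natrX ler_nat; exact: ltn_expl.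
  move=> /le_trans; apply; rewrite (le_trans (y := z ^+ n))//.
    by rewrite lerXn2r// ?nnegrE ?mulr_ge0// /z lerDl.
  by rewrite exprS ler_peMl// exprn_ge0.
move: cz; rewrite -(is_cvg_series_restrict 1) /pseries.
move=> /cvg_ex[l cl]; apply/cvg_ex; exists l.
rewrite -cvg_shiftS in cl.
rewrite (_ : series _ = fun n => \sum_(1 <= i < n.+1) `|a i| * z ^+ i) //.
by apply: funext => n; rewrite /series /= big_add1.
Qed.

Lemma is_derive_pseries (R : realType) (a : nat -> R) :
  (forall x, cvgn (pseries a x)) -> forall x,
  is_derive x (1 : R) (fun x => limn (pseries a x))
    (limn (pseries (pseries_diffs a) x)).
Proof.
move=> ca x; apply: (pseries_snd_diffs (K := `|x| + 1)).
- exact: ca.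
- exact: is_cvg_pseries_diffs.
- by apply: is_cvg_pseries_diffs; exact: is_cvg_pseries_diffs.
by rewrite [ltRHS]ger0_norm ?ltrDl// addr_ge0.
Qed.

Lemma limn_pseries0 (R : realType) (a : nat -> R) : limn (pseries a 0) = a 0%N.
Proof.
apply/cvg_lim => //; rewrite -cvg_shiftS.
rewrite (_ : (fun _ => _) = cst (a 0%N)); first exact: cvg_cst.
apply: funext => n; rewrite /pseries /series /= big_nat_recl// expr0 mulr1.
by rewrite big1 ?addr0// => i _; rewrite expr0n mulr0.
Qed.

(** The derivative of a vanishing power series is again a vanishing power
    series, and its coefficients are positive multiples of the shifted ones; so
    everything reduces to the constant term, the value at 0. *)
Lemma pseries_eq0 (R : realType) (a : nat -> R) :
  (forall x, pseries a x @ \oo --> 0)%classic -> forall n, a n = 0.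
Proof.
move=> a0 n; elim: n a a0 => [|n IHn] a a0.
  by rewrite -limn_pseries0; exact/cvg_lim.
have ca x : cvgn (pseries a x) by apply/cvg_ex; exists 0.
have : pseries_diffs a n = 0.
  apply: IHn => x; have cd := is_cvg_pseries_diffs _ _ ca x.
  have dF := is_derive_pseries _ _ ca x.
  have F0 : (fun x => limn (pseries a x)) = cst 0.
    by apply: funext => y; exact/cvg_lim.
  have := @derive_val _ _ _ _ _ _ _ dF; rewrite F0 derive_cst => ->; exact: cd.
by move/eqP; rewrite mulf_eq0 pnatr_eq0 /= => /eqP.
Qed.

(** Compare coefficients in E' = (2t - 2w) E, where E(w) = exp(2tw - w^2) is
    differentiated termwise. *)
Lemma hermite_gen_coef (R : realType) (t : R) (a : nat -> R) :
  (forall w, pseries a w @ \oo --> expR (2 * t * w - w ^+ 2))%classic ->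
  [/\ a 0%N = 1, a 1%N = 2 * t &
   forall n, n.+2%:R * a n.+2 = 2 * t * a n.+1 - 2 * a n].
Proof.
move=> aE.
have ca x : cvgn (pseries a x) by apply/cvg_ex; eexists; exact: aE.
have FE : (fun x => limn (pseries a x)) = fun w => expR (2 * t * w - w ^+ 2).
  by apply: funext => w; exact/cvg_lim.
have dE w : limn (pseries (pseries_diffs a) w)
    = (2 * t - 2 * w) * expR (2 * t * w - w ^+ 2).
  have dF := is_derive_pseries _ _ ca w.
  rewrite FE in dF; rewrite -(@derive_val _ _ _ _ _ _ _ dF).
  have dq : is_derive w (1 : R) (fun w => 2 * t * w - w ^+ 2) (2 * t - 2 * w).
    apply: is_derive_eq.
    by rewrite /GRing.scale /=; ring.
  have de := is_derive1_comp (is_derive_expR _) dq; rewrite derive_val.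
  exact: mulrC.
(* s is the coefficient sequence of w E(w), and r that of the zero function
   E' - 2t E + 2w E. *)
pose s i := if i is j.+1 then a j else 0.
pose r i := pseries_diffs a i - 2 * t * a i + 2 * s i.
have sE w : (pseries s w @ \oo --> w * expR (2 * t * w - w ^+ 2))%classic.
  rewrite -cvg_shiftS.
  rewrite (_ : (fun _ => _) = (fun n => w * pseries a w n)); first exact: cvgMr.
  apply: funext => n; rewrite /pseries /series /= big_nat_recl//= mul0r add0r.
  by rewrite mulr_sumr; apply: eq_bigr => i _; rewrite exprS mulrCA.
have r0 : forall n, r n = 0.
  apply: pseries_eq0 => w.
  rewrite (_ : pseries r w = (fun n => pseries (pseries_diffs a) w n -
    2 * t * pseries a w n + 2 * pseries s w n)); last first.
    apply: funext => n; rewrite /pseries /series /= !mulr_sumr.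
    rewrite -sumrB -big_split.
    by apply: eq_bigr => i _ /=; rewrite /r; ring.
  have cd := is_cvg_pseries_diffs _ _ ca w; rewrite dE in cd.
  have -> : 0 = (2 * t - 2 * w) * expR (2 * t * w - w ^+ 2)
     - 2 * t * expR (2 * t * w - w ^+ 2)
     + 2 * (w * expR (2 * t * w - w ^+ 2)) :> R.
    by ring.
  by apply: cvgD; [apply: cvgB => //; exact: cvgMr|exact: cvgMr].
have a0 : a 0%N = 1.
  rewrite -limn_pseries0; apply/cvg_lim => //; have := aE 0.
  by rewrite mulr0 expr0n subr0 expR0.
split => //.
- by have := r0 0%N; rewrite /r /pseries_diffs /= a0; lra.
- by move=> n; have := r0 n.+1; rewrite /r /pseries_diffs /=; lra.
Qed.

(** * Hermite polynomials from their recurrence *)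

(** Stated over an arbitrary commutative ring so that it can be transported from
    real to complex coefficients by [hermite_rec_map]. *)
Definition hermite_rec {S : comNzRingType} (h : nat -> {poly S}) :=
  [/\ h 0%N = 1, h 1%N = 'X *+ 2 &
   forall n, h n.+2 = ('X * h n.+1) *+ 2 - h n *+ (2 * n.+1)].

Lemma horner_inj (F : numDomainType) (p q : {poly F}) :
  (forall x, p.[x] = q.[x]) -> p = q.
Proof.
move=> epq; apply/eqP; rewrite -subr_eq0; apply/eqP.
apply: (roots_geq_poly_eq0 (rs := [seq i%:R | i <- iota 0 (size (p - q))])).
- by apply/allP => x _; rewrite rootE hornerD hornerN epq subrr.
- by rewrite map_inj_uniq ?iota_uniq// => i j /eqP; rewrite eqr_nat => /eqP.
- by rewrite size_map size_iota.
Qed.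

(** The recurrence satisfied by the Taylor coefficients H_n / n! is the usual
    one for the H_n. *)
Lemma scaled_hermite_rec (F : numFieldType) (t x y z : F) n :
  n.+2%:R * (x / n.+2`!%:R) = 2 * t * (y / n.+1`!%:R) - 2 * (z / n`!%:R) <->
  x = (t * y) *+ 2 - z *+ (2 * n.+1).
Proof.
have f0 : (n`!%:R : F) != 0 by exact: natr_fact_neq0.
have k0 : (n.+1%:R : F) != 0 by rewrite pnatr_eq0.
have l0 : (n.+2%:R : F) != 0 by rewrite pnatr_eq0.
rewrite !factS (natrM _ n.+2) !(natrM _ n.+1) -[z *+ _]mulr_natr (natrM _ 2).
move: (n`!%:R : F) (n.+1%:R : F) (n.+2%:R : F) f0 k0 l0 => f k l f0 k0 l0.
rewrite (_ : l * _ = (k * f)^-1 * x); last by field; rewrite f0 k0.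
rewrite (_ : _ - 2 * (z / f) =
  (k * f)^-1 * ((t * y) *+ 2 - z * (2 * k))); last by field; rewrite f0 k0.
by split=> [/(mulfI _)|->]//; apply; rewrite invr_neq0// mulf_neq0.
Qed.

Lemma is_hermite_rec (R : realType) (H : nat -> {poly R}) :
  is_hermite H -> hermite_rec H.
Proof.
move=> hH.
have gen t : [/\ (H 0%N).[t] / 0`!%:R = 1, (H 1%N).[t] / 1`!%:R = 2 * t &
   forall n, n.+2%:R * ((H n.+2).[t] / n.+2`!%:R) =
     2 * t * ((H n.+1).[t] / n.+1`!%:R) - 2 * ((H n).[t] / n`!%:R)].
  apply: (hermite_gen_coef _ t (fun n => (H n).[t] / n`!%:R)) => w.
  rewrite (_ : pseries _ _ = series (fun n => (H n).[t] * w ^+ n / n`!%:R)).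
    exact: hH.
  by congr series; apply: funext => n; rewrite /= mulrAC.
split.
- by apply: horner_inj => t; have [+ _ _] := gen t; rewrite divr1 hornerC.
- apply: horner_inj => t; have [_ + _] := gen t.
  by rewrite divr1 hornerMn hornerX mulr_natl.
move=> n; apply: horner_inj => t; have [_ _ /(_ n)] := gen t.
by rewrite hornerD hornerN !hornerMn hornerM hornerX => /scaled_hermite_rec.
Qed.

Lemma hermite_rec_map (S T : comNzRingType) (f : {rmorphism S -> T}) h :
  hermite_rec h -> hermite_rec (fun n => map_poly f (h n)).
Proof.
move=> [h0 h1 h2]; split; first by rewrite h0 rmorph1.
- by rewrite h1 rmorphMn /= map_polyX.
- by move=> n; rewrite h2 rmorphB !rmorphMn rmorphM /= map_polyX.
Qed.

(** Differentiating the recurrence for H_(n+2) and using the formula for n + 1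
    and n, the terms other than 2 H_(n+1) recombine, by the recurrence one step
    lower, into a multiple of H_(n+1).  At index 0 the value given by the
    truncated predecessor is irrelevant, being multiplied by 0. *)
Lemma hermite_deriv (S : comNzRingType) (h : nat -> {poly S}) :
  hermite_rec h -> forall n, (h n)^`() = h n.-1 *+ (2 * n).
Proof.
move=> [h0 h1 h2] n; have [//] : (h n)^`() = h n.-1 *+ (2 * n) /\
  (h n.+1)^`() = h n *+ (2 * n.+1).
(* The recurrence has order two, so two consecutive cases are carried along. *)
elim: n => [|n [IH0 IH1]].
  by rewrite h0 -[1]/(1%:P) derivC mulr0n h1 derivMn derivX.
split => //; rewrite [in LHS]h2 derivB !derivMn derivM derivX IH0 IH1.
case: n {IH0 IH1} => [|n]; first by rewrite h0 h1 /=; ring.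
by rewrite [h n.+2]h2 /=; ring.
Qed.

Lemma hermite_ode (S : comNzRingType) (h : nat -> {poly S}) :
  hermite_rec h ->
  forall n, (h n)^`()^`() - ('X * (h n)^`()) *+ 2 = - (h n *+ (2 * n)).
Proof.
move=> hr; have dh := hermite_deriv _ _ hr.
move=> [|[|n]]; rewrite !dh ?derivMn ?dh /=.
- by rewrite !mulr0n mulr0 mul0rn subrr oppr0.
- by case: hr => h0 h1 _; rewrite h0 h1; ring.
- by case: hr => _ _ h2; rewrite h2; ring.
Qed.

(** * Convolution and Appell sequences *)

(** Associativity of convolution, inherited from the multiplication of
    polynomials: truncating all the sequences beyond n does not affect the n-th
    term. *)
Lemma convolA (S : comNzRingType) (f g h : nat -> S) n :
  \sum_(k < n.+1) f k * (\sum_(j < (n - k).+1) g j * h (n - k - j)%N) =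
  \sum_(k < n.+1) (\sum_(j < k.+1) f j * g (k - j)%N) * h (n - k)%N.
Proof.
pose P u := \poly_(i < n.+1) (u i : S).
have PE u v m : (m <= n)%N ->
    (P u * P v)`_m = \sum_(j < m.+1) u j * v (m - j)%N.
  move=> mn; rewrite coefM; apply: eq_bigr => j _.
  have jn : (j < n.+1)%N by rewrite (leq_trans (ltn_ord j)).
  have mjn : (m - j < n.+1)%N by rewrite ltnS (leq_trans (leq_subr _ _)).
  by rewrite !coef_poly jn mjn.
have := congr1 (fun p : {poly S} => p`_n) (mulrA (P f) (P g) (P h)).
rewrite !coefM => E.
transitivity (\sum_(j < n.+1) (P f)`_j * (P g * P h)`_(n - j)).
  by apply: eq_bigr => k _; rewrite PE ?leq_subr// coef_poly ltn_ord.
rewrite E; apply: eq_bigr => k _; rewrite PE -1?ltnS//.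
by rewrite coef_poly ltnS leq_subr.
Qed.

Lemma sum_ord_trunc (V : nmodType) (F : nat -> V) m n :
  (forall k, (minn m n <= k)%N -> F k = 0) ->
  \sum_(k < m) F k = \sum_(k < n) F k.
Proof.
move=> F0; wlog mn : m n F0 / (m <= n)%N.
  move=> E; have [/E->//|/ltnW nm] := leqP m n.
  by rewrite (E n m)// => k; rewrite minnC; exact: F0.
rewrite (minn_idPl mn) in F0.
rewrite -(subnK mn) addnC big_split_ord /= [X in _ + X]big1 ?addr0// => i _.
by rewrite F0 ?leq_addr.
Qed.

(** The binomial convolution of a scalar sequence and a sequence of polynomials;
    [phi] is the instance given by [bcoef] and the Hermite polynomials. *)
Definition appell {C : numFieldType} (b : nat -> C) (h : nat -> {poly C})
    (n : nat) : {poly C} :=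
  \sum_(0 <= j < n.+1) ('C(n, j)%:R * b j) *: h (n - j)%N.

(** Dividing by n! turns binomial convolution into ordinary convolution. *)
Lemma appell_fact (C : numFieldType) (b : nat -> C) (h : nat -> {poly C}) n :
  (n`!%:R)^-1 *: appell b h n =
  \sum_(j < n.+1) (b j / j`!%:R)%:P * ((n - j)`!%:R^-1 *: h (n - j)%N).
Proof.
rewrite /appell big_mkord scaler_sumr; apply: eq_bigr => j _.
rewrite mul_polyC !scalerA; congr (_ *: _).
have -> : n`!%:R = 'C(n, j)%:R * (j`!%:R * (n - j)`!%:R) :> C.
  by rewrite -!natrM bin_fact // -ltnS.
have fN0 m : (m`!%:R : C) != 0 by exact: natr_fact_neq0.
have : ('C(n, j)%:R : C) != 0 by rewrite pnatr_eq0 -lt0n bin_gt0 -ltnS.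
move: (fN0 j) (fN0 (n - j)%N).
move: ('C(n, j)%:R : C) (j`!%:R : C) ((n - j)`!%:R : C) (b j) => x y z w *.
by field; apply/and3P.
Qed.

(** With * the convolution and beta_j = b_j / j! its inverse to [a],
    associativity gives a * (beta * h) = (a * beta) * h = h, where h stands for
    the sequence h_n / n!. *)
Lemma appell_conv (C : numFieldType) (a b : nat -> C) (h : nat -> {poly C}) :
  (forall n, \sum_(k < n.+1) a k * (b (n - k)%N / (n - k)`!%:R)
    = (n == 0%N)%:R) ->
  forall n, \sum_(k < n.+1) a k *: ((n - k)`!%:R^-1 *: appell b h (n - k)%N) =
    (n`!%:R)^-1 *: h n.
Proof.
move=> ab n; under eq_bigr do rewrite appell_fact -mul_polyC.
rewrite (convolA _ (fun k => (a k)%:P) (fun j => (b j / j`!%:R)%:P)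
   (fun i => i`!%:R^-1 *: h i)).
have ab' k : \sum_(j < k.+1) (a j)%:P * (b (k - j)%N / (k - j)`!%:R)%:P
    = ((k == 0)%N%:R : {poly C}).
  rewrite -polyC_natr -ab rmorph_sum.
  by apply: eq_bigr => j _; rewrite /= -polyCM.
under eq_bigr do rewrite ab'.
rewrite big_ord_recl subn0 mul1r big1 ?addr0// => i _.
by rewrite mul0r.
Qed.

(** The guard encodes the convention that terms of negative index vanish; it
    allows sums over a range of k that does not depend on n. *)
Definition appell_term {C : numFieldType} (a b : nat -> C)
    (h : nat -> {poly C}) (n k : nat) : {poly C} :=
  if (k <= n)%N then a k *: ((n - k)`!%:R^-1 *: appell b h (n - k)%N) else 0.

(** When [a] is the coefficient sequence of a polynomial of degree at most d,
    the convolution is a sum over 0 <= k <= d whatever n is. *)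
Lemma appell_conv_trunc (C : numFieldType) (a b : nat -> C)
    (h : nat -> {poly C}) d :
  (forall n, \sum_(k < n.+1) a k * (b (n - k)%N / (n - k)`!%:R)
    = (n == 0%N)%:R) ->
  (forall k, (d < k)%N -> a k = 0) ->
  forall n, \sum_(k < d.+1) appell_term a b h n k = (n`!%:R)^-1 *: h n.
Proof.
move=> ab ad n; rewrite -(appell_conv _ _ _ _ ab).
rewrite (@sum_ord_trunc _ _ _ n.+1) => [|k].
  by apply: eq_bigr => k _; rewrite /appell_term -ltnS ltn_ord.
rewrite geq_min => /orP[dk|nk]; rewrite /appell_term.
  by rewrite ad// scale0r if_same.
by rewrite leqNgt nk.
Qed.

(** The differentiation rule of [h] passes to its binomial convolution with [b]
    because (n + 1 - j) C(n + 1, j) = (n + 1) C(n, j). *)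
Lemma appell_deriv (C : numFieldType) (b : nat -> C) (h : nat -> {poly C}) :
  (forall n, (h n)^`() = h n.-1 *+ (2 * n)) ->
  forall n, (appell b h n)^`() = appell b h n.-1 *+ (2 * n).
Proof.
move=> dh [|n].
  by rewrite /appell big_nat1 derivZ dh mulr0n scaler0.
rewrite /appell !big_mkord raddf_sum big_ord_recr /= subnn derivZ dh.
rewrite muln0 mulr0n scaler0 addr0 -sumrMnl; apply: eq_bigr => j _.
rewrite derivZ dh subSn -1?ltnS//=.
rewrite -[h _ *+ _]scaler_nat -[RHS]scaler_nat !scalerA; congr (_ *: _).
have : ((n - j).+1 * 'C(n.+1, j) = n.+1 * 'C(n, j))%N.
  by rewrite -subSn -1?ltnS// mul_bin_down.
move/(congr1 (fun m => m%:R : C)); rewrite !natrM => e.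
transitivity (2 * b j * ((n - j).+1%:R * 'C(n.+1, j)%:R)); first by ring.
by rewrite e; ring.
Qed.

Lemma appell_derivn (C : numFieldType) (b : nat -> C) (h : nat -> {poly C}) :
  (forall n, (h n)^`() = h n.-1 *+ (2 * n)) ->
  forall n k, (appell b h n)^`(k) =
    if (k <= n)%N
    then (2 ^+ k * n`!%:R) *: ((n - k)`!%:R^-1 *: appell b h (n - k)%N)
    else 0.
Proof.
move=> dh n k.
have fN0 m : (m`!%:R : C) != 0 by exact: natr_fact_neq0.
elim: k => [|k IHk].
  by rewrite derivn0 subn0 expr0 mul1r scalerA mulfV// scale1r.
rewrite derivnS IHk; case: ltngtP => [kn|kn|->]; last 2 first.
- by rewrite linear0.
- by rewrite !derivZ subnn appell_deriv// muln0 mulr0n !scaler0.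
rewrite !derivZ appell_deriv// -subnS; move: (fN0 (n - k)%N).
rewrite (_ : (n - k = (n - k.+1).+1)%N); last by rewrite subnSK.
rewrite -[appell _ _ _ *+ _]scaler_nat factS !natrM !scalerA exprS.
move: (fN0 (n - k.+1)%N) => f0.
rewrite mulf_eq0 negb_or => /andP[g0 _]; congr (_ *: _).
by field; rewrite f0 nat1r.
Qed.

(** * The recurrence relation and the differential equation *)

Theorem corollary5 (R : realType) (d : nat) (c : nat -> R[i])
    (p : {poly R[i]}) (H : nat -> {poly R})
    (hd : (0 < d)%N)
    (hp : p = \sum_(0 <= k < d.+1) c k *: 'X^k)
    (hcd : c d != 0) (hc0 : c 0%N != 0)
    (hH : is_hermite H) :
  (forall (n : nat) (t : R[i]), (0 < n)%N ->
     n.+1%:R * (\sum_(0 <= k < d.+1)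
        (phiz H p (n%:Z + 1 - k%:Z)).[t]
          * (c k * 2 ^+ k / (factz (n%:Z + 1 - k%:Z))%:R))
     + 2 * (\sum_(0 <= k < d.+1)
        (phiz H p (n%:Z - 1 - k%:Z)).[t]
          * (c k * 2 ^+ k / (factz (n%:Z - 1 - k%:Z))%:R))
     = 2 * t * (\sum_(0 <= k < d.+1)
        (phiz H p (n%:Z - k%:Z)).[t]
          * (c k * 2 ^+ k / (factz (n%:Z - k%:Z))%:R)))
  /\ (forall t : R[i],
        c 0%N * (phi H p 1).[t] + 2 * c 1%N * (phi H p 0).[t]
        = 2 * c 0%N * t * (phi H p 0).[t])
  /\ (forall (n : nat) (t : R[i]),
        \sum_(0 <= k < d.+1) c k * ((phi H p n)^`(k.+2)).[t]
        - 2 * t * (\sum_(0 <= k < d.+1) c k * ((phi H p n)^`(k.+1)).[t])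
        = - 2 * n%:R * (\sum_(0 <= k < d.+1) c k * ((phi H p n)^`(k)).[t])).
Proof.
pose A := \poly_(k < d.+1) (c k * 2 ^+ k).
pose h n := map_poly (real_complex R) (H n).
have hr : hermite_rec h by apply: hermite_rec_map; exact: is_hermite_rec.
have dh := hermite_deriv _ _ hr.
have fN0 m : (m`!%:R : R[i]) != 0 by exact: natr_fact_neq0.
have coefA k : (k <= d)%N -> A`_k = c k * 2 ^+ k.
  by move=> kd; rewrite coef_poly ltnS kd.
have evalA w : A.[w] = p.[2 * w].
  rewrite horner_poly hp big_mkord horner_sum; apply: eq_bigr => k _.
  by rewrite hornerZ hornerXn exprMn mulrA.
have ab n : \sum_(k < n.+1) A`_k * (bcoef p (n - k) / (n - k)`!%:R)
    = (n == 0%N)%:R.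
  rewrite -(inv_coefs _ A); last first.
    by rewrite horner_coef0 coefA// expr0 mulr1.
  apply: eq_bigr => k _; rewrite /bcoef.
  rewrite (_ : (fun w => _) = (fun w => (A.[w])^-1 : R[i]^o))//.
  by apply: funext => w; rewrite evalA.
pose T := appell_term (fun k => A`_k) (bcoef p) h.
have phiE n : phi H p n = appell (bcoef p) h n by [].
have conv m : \sum_(k < d.+1) T m k = (m`!%:R)^-1 *: h m.
  apply: appell_conv_trunc => // k dk.
  by rewrite coef_poly ltnNge dk.
have recE (m : nat) t : \sum_(0 <= k < d.+1) (phiz H p (m%:Z - k%:Z)).[t]
    * (c k * 2 ^+ k / (factz (m%:Z - k%:Z))%:R) = (h m).[t] / m`!%:R.
  rewrite big_mkord -[RHS]mulrC -hornerZ -conv horner_sum.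
  apply: eq_bigr => k _; have kd : (k <= d)%N by rewrite -ltnS.
  rewrite /T /appell_term coefA//; have [km|mk] := leqP k m.
    by rewrite subzn// !hornerZ /= phiE mulrC mulrA.
  by rewrite -opprB subzn ?(ltnW mk)// -(subnSK mk) /= !horner0 mul0r.
split=> [[//|n] t _|].
  rewrite -PoszD addn1 -predn_int// !recE.
  have [_ _ h2] := hr.
  have /(scaled_hermite_rec _ t) -> :
    (h n.+2).[t] = (t * (h n.+1).[t]) *+ 2 - (h n).[t] *+ (2 * n.+1).
    by rewrite h2 hornerD hornerN !hornerMn hornerM hornerX.
  by rewrite subrK.
split=> [t|n t].
  have [h0 h1 _] := hr.
  have /(congr1 (horner^~ t)) := appell_conv _ _ _ h ab 0.
  have /(congr1 (horner^~ t)) := appell_conv _ _ _ h ab 1.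
  rewrite big_ord_recl !big_ord1 /= !subn0 subnn h0 h1 !invr1 !scale1r.
  rewrite coefA// coefA// expr0 mulr1 expr1 -!phiE.
  rewrite hornerD !hornerZ hornerMn hornerX hornerC => e1 e0.
  rewrite [2 * c 1%N]mulrC e1 -mulr_natl -[2 * t]mulr1 -[X in _ * X = _]e0.
  by ring.
have sumE j : \sum_(0 <= k < d.+1) c k * ((phi H p n)^`(j + k)).[t]
    = ((h n)^`(j)).[t].
  have -> : h n = \sum_(k < d.+1) c k *: (phi H p n)^`(k).
    apply: (scalerI (invr_neq0 (fN0 n))); rewrite -conv scaler_sumr.
    apply: eq_bigr => k _; have kd : (k <= d)%N by rewrite -ltnS.
    rewrite phiE appell_derivn// /T /appell_term coefA//.
    case: leqP => _; last by rewrite !scaler0.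
    rewrite !scalerA; congr (_ *: _).
    have := fN0 n; have := fN0 (n - k)%N.
    move: (n`!%:R : R[i]) ((n - k)`!%:R : R[i]) (2 ^+ k : R[i]) => f g e g0 f0.
    by field; rewrite f0 g0.
  rewrite (raddf_sum (derivn j)) /= horner_sum big_mkord; apply: eq_bigr => k _.
  by rewrite derivnZ hornerZ /derivn iterD.
rewrite (sumE 2%N) (sumE 1%N) (sumE 0%N).
have /(congr1 (horner^~ t)) := hermite_ode _ _ hr n.
rewrite hornerD !hornerN !hornerMn hornerM hornerX => /=.
rewrite -mulrA [2 * (t * _)]mulr_natl => ->.
by rewrite mulNr -natrM mulNr mulr_natl.
Qed.
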